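(* Let $g=(R,\vec b)\in\mathrm{SE}(3)$, with the origin chosen on the screw axis of $g$ if $R\neq\mathrm{Id}$, and let $\iota_{\mathfrak z}:\mathfrak z(g)\hookrightarrow\mathfrak{se}(3)$ denote the inclusion of the Lie algebra of its centralizer $Z(g)$. The momentum map for the $Z(g)$-action on $(\mathcal M_g,\Omega^{MW})$ is $$\mu_g:\mathcal M_g\to\mathfrak z(g)^*,\qquad \gamma\mapsto\iota_{\mathfrak z}^*\begin{pmatrix}\mathscr V(\gamma)\\ \mathscr A(\gamma)\end{pmatrix},$$ i.e. for every $\xi=(\vec\omega,\vec v)\in\mathfrak z(g)$ one has $\iota_{X_\xi}\Omega^{MW}=d\langle\mu_g\mid\xi\rangle$ on $\mathcal M_g$, where $X_\xi(\gamma)=\vec\omega\times\vec\gamma+\vec v$ and $\langle\mu_g(\gamma)\mid\xi\rangle=\langle\mathscr V(\gamma),\vec\omega\rangle+\langle\mathscr A(\gamma),\vec v\rangle$.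
   Context: Fix a translation $\tau:\mathbb R\to\mathbb R$, $\tau(t)=t+T_0$ with $T_0>0$. An element $g=(R,\vec b)\in\mathrm{SE}(3)$, $R\in \mathrm{SO}(3)$, $\vec b\in\mathbb R^3$, acts by $g(\vec x)=R\vec x+\vec b$. $\mathcal M_g$ is the space of smooth immersions $\gamma:\mathbb R\to\mathbb R^3$ with $\gamma(\tau(t))=g(\gamma(t))$ for all $t$ ($\vec\gamma$ denotes the corresponding vector-valued function). Its tangent space $T_\gamma\mathcal M_g$ consists of smooth $X:\mathbb R\to\mathbb R^3$ with $X(\tau(t))=R\,X(t)$. $Z(g)=\{h\in\mathrm{SE}(3):hg=gh\}$ acts on $\mathcal M_g$ by $\gamma\mapsto h\circ\gamma$; its Lie algebra is $\mathfrak z(g)\subset\mathfrak{se}(3)$. $\mathfrak{se}(3)$ is identified with pairs $(\vec\omega,\vec v)\in\mathbb R^3\times\mathbb R^3$ (infinitesimal motion $\vec x\mapsto\vec\omega\times\vec x+\vec v$), and its dual with pairs $(\vec l,\vec p)$ via $\langle(\vec l,\vec p)\mid(\vec\omega,\vec v)\rangle=\langle\vec l,\vec\omega\rangle+\langle\vec p,\vec v\rangle$. If $R\ne\mathrm{Id}$, the origin is chosen on the screw axis of $g$, so that $R\vec b=\vec b$; let $\vec s_g$ be a unit vector with $R\vec s_g=\vec s_g$. If $R=\mathrm{Id},\vec b\ne0$, let $\vec s_g=\vec b/|\vec b|$. Then $\mathfrak z(g)$ is $\mathfrak{se}(3)$ if $g=\mathrm{id}$; $\{(\vec\omega,\vec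 v):\vec\omega\parallel\vec s_g\}$ if $R=\mathrm{Id},\vec b\neq0$; $\{(\vec\omega,\vec v):\vec\omega,\vec v\parallel\vec s_g\}$ if $R\ne\mathrm{Id}$. On a fundamental domain $I=[t_0,\tau(t_0)]$, with $ds$ the arc-length measure and $'$ the arc-length derivative: $\mathscr A(\gamma)=\tfrac12\int_I\vec\gamma\times\vec\gamma'\,ds-\tfrac12\vec b\times\vec\gamma(t_0)$, $\mathscr V(\gamma)=\tfrac13\int_I\vec\gamma\times(\vec\gamma\times\vec\gamma')\,ds-\tfrac16\vec\gamma(t_0)\times(\vec b\times\vec\gamma(t_0))$. The Marsden–Weinstein form is $\Omega^{MW}_\gamma(X,Y)=\int_I\det(X,Y,d\vec\gamma)=\int_I\det(X(t),Y(t),\partial_t\vec\gamma(t))\,dt$ for $X,Y\in T_\gamma\mathcal M_g$. Momentum map of an action on a (pre-)symplectic manifold $(M,\Omega)$ with Lie algebra $\mathfrak g$: a map $\mu:M\to\mathfrak g^*$ with $\iota_{X_\xi}\Omega=d\langle\mu\mid\xi\rangle$ for every $\xi\in\mathfrak g$, where $X_\xi$ is the vector field generated by $\xi$ and $\iota_X\Omega=\Omega(X,\cdot)$. *)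

(* Defs.v *)
From HB Require Import structures.
From mathcomp Require Import all_boot all_order all_algebra.
From mathcomp Require Import all_classical all_reals all_analysis.

Set Implicit Arguments.
Unset Strict Implicit.
Unset Printing Implicit Defensive.

Import Order.TTheory GRing.Theory Num.Theory.
Import numFieldNormedType.Exports.
Local Open Scope classical_set_scope.
Local Open Scope ring_scope.

(* For a finite-dimensional domain [U], [f] is C^(k+1) iff it is differentiable
   and every directional derivative of it is C^k. *)
Fixpoint Ck (R : realType) (U V : normedModType R) (k : nat) (f : U -> V)
    : Prop :=
  match k with
  | 0 => continuous f
  | k'.+1 => (forall x, differentiable f x) /\
             (forall v, Ck k' (fun x => 'D_v f x))
  end.

Definition smooth (R : realType) (U V : normedModType R) (f : U -> V) : Prop :=
  forall k, Ck k f.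

Section EuclideanSpace.
Context {R : realType}.
Implicit Types u v w : 'cV[R]_3.

Definition dot u v : R := \sum_(i < 3) u i 0 * v i 0.

(* The norm [`|u|] that MathComp-Analysis puts on ['cV_3] is the sup norm. *)
Definition enorm u : R := Num.sqrt (dot u u).

(* Indices are added modulo 3 in the ring ['I_3]. *)
Definition cross u v : 'cV[R]_3 :=
  \col_(i < 3) (u (i + 1) 0 * v (i + 2%:R) 0 - u (i + 2%:R) 0 * v (i + 1) 0).

Definition det3 u v w : R := \det (row_mx u (row_mx v w) : 'M[R]_3).

End EuclideanSpace.

Section RigidMotions.
Context {R : realType}.

Implicit Types g h : ('M[R]_3 * 'cV[R]_3)%type.

Definition SO3 : set 'M[R]_3 := [set Q | Q^T *m Q = 1%:M /\ \det Q = 1].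

Definition SE3 : set ('M[R]_3 * 'cV[R]_3) := [set g | SO3 g.1].

Definition act g (x : 'cV[R]_3) : 'cV[R]_3 := g.1 *m x + g.2.

Definition se3_one : 'M[R]_3 * 'cV[R]_3 := (1%:M, 0).

Definition se3_mul g h : 'M[R]_3 * 'cV[R]_3 :=
  (g.1 *m h.1, g.1 *m h.2 + g.2).

Definition centralizer g : set ('M[R]_3 * 'cV[R]_3) :=
  [set h | SE3 h /\ se3_mul h g = se3_mul g h].

(* [xi = (omega, v)] in se(3) as an infinitesimal motion. *)
Definition inf_motion (xi : 'cV[R]_3 * 'cV[R]_3) (x : 'cV[R]_3) : 'cV[R]_3 :=
  cross xi.1 x + xi.2.

(* z(g), the Lie algebra of Z(g): the velocities at the identity of the smooth
   curves in Z(g), an element of se(3) being identified with the vector field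
   [inf_motion xi] on R^3. *)
Definition zlie g : set ('cV[R]_3 * 'cV[R]_3) :=
  [set xi | exists h : R -> 'M[R]_3 * 'cV[R]_3,
    [/\ smooth h, h 0 = se3_one, (forall e, centralizer g (h e)) &
        forall x, is_derive (0 : R) (1 : R) (fun e => act (h e) x)
                    (inf_motion xi x)]].

(* [lp = (l, p)] in se(3)^* paired with [xi = (omega, v)] in se(3). *)
Definition pairing (lp xi : 'cV[R]_3 * 'cV[R]_3) : R :=
  dot lp.1 xi.1 + dot lp.2 xi.2.

(* Linearity of a functional on the subspace z(g). *)
Definition zdual g : set (zlie g -> R) :=
  [set l | forall (a : R) (x y z : zlie g),
    \val z = a *: \val x + \val y -> l z = a * l x + l y].

(* The restriction se(3)^* -> z(g)^*, dual to the inclusion of z(g). *)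
Definition iota_dual g (lp : 'cV[R]_3 * 'cV[R]_3) : zlie g -> R :=
  fun xi => pairing lp (\val xi).

End RigidMotions.

Section CurvesWithMonodromy.
Context {R : realType}.
Variables (T0 : R) (g : 'M[R]_3 * 'cV[R]_3).
Implicit Types gamma X Y : R -> 'cV[R]_3.

Definition tau (t : R) : R := t + T0.

Definition Mg : set (R -> 'cV[R]_3) :=
  [set gamma | [/\ smooth gamma, (forall t, derive1 gamma t != 0) &
                   forall t, gamma (tau t) = act g (gamma t)]].

Definition TMg : set (R -> 'cV[R]_3) :=
  [set X | smooth X /\ forall t, X (tau t) = g.1 *m X t].

Definition speed gamma (t : R) : R := enorm (derive1 gamma t).

Definition arc_deriv gamma (t : R) : 'cV[R]_3 :=
  (speed gamma t)^-1 *: derive1 gamma t.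

Variable t0 : R.

(* The integral over [t0, tau t0] with respect to ds = |d gamma/dt| dt. *)
Definition int_ds gamma (F : R -> 'cV[R]_3) : 'cV[R]_3 :=
  \col_(i < 3) (\int[lebesgue_measure]_(t in `[t0, tau t0])
                  (F t i 0 * speed gamma t))%R.

Definition area_vector gamma : 'cV[R]_3 :=
  2^-1 *: int_ds gamma (fun t => cross (gamma t) (arc_deriv gamma t))
  - 2^-1 *: cross g.2 (gamma t0).

Definition volume_vector gamma : 'cV[R]_3 :=
  3^-1 *: int_ds gamma
            (fun t => cross (gamma t) (cross (gamma t) (arc_deriv gamma t)))
  - 6^-1 *: cross (gamma t0) (cross g.2 (gamma t0)).

Definition OmegaMW gamma X Y : R :=
  (\int[lebesgue_measure]_(t in `[t0, tau t0])
     det3 (X t) (Y t) (derive1 gamma t))%R.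

(* [df] is the value at [Y] of the differential at [gamma] of the function [f]
   on M_g: the derivative at 0 of [f] along any smooth curve [e |-> c (e, _)]
   in M_g through [gamma] with velocity [Y].  Smoothness of such a curve is
   joint smoothness in the parameter [e] and the time [t]. Since immersions are
   open among equivariant maps, [gamma + e Y] is such a curve for any [Y] in
   T_gamma M_g, and so there always is one. *)
Definition is_differential (f : (R -> 'cV[R]_3) -> R) gamma Y (df : R) : Prop :=
  forall c : R * R -> 'cV[R]_3,
    smooth c ->
    (\forall e \near (0 : R), Mg (fun t => c (e, t))) ->
    (forall t, c (0, t) = gamma t) ->
    (forall t, is_derive (0 : R) (1 : R) (fun e => c (e, t)) (Y t)) ->
    is_derive (0 : R) (1 : R) (fun e => f (fun t => c (e, t))) df.

(* The vector field on M_g generated by [xi]. *)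
Definition gen_field (xi : 'cV[R]_3 * 'cV[R]_3) gamma : R -> 'cV[R]_3 :=
  fun t => inf_motion xi (gamma t).

Definition is_momentum_map (mu : (R -> 'cV[R]_3) -> zlie g -> R) : Prop :=
  forall gamma, Mg gamma ->
    zdual (mu gamma) /\
    forall xi : zlie g,
      TMg (gen_field (\val xi) gamma) /\
      forall Y, TMg Y ->
        is_differential (fun c => mu c xi) gamma Y
          (OmegaMW gamma (gen_field (\val xi) gamma) Y).

Definition mu_g gamma : zlie g -> R :=
  iota_dual (volume_vector gamma, area_vector gamma).

End CurvesWithMonodromy.

Arguments mu_g {R} T0 g t0 gamma _.
Arguments is_momentum_map {R} T0 g t0 mu.

(* Main.v *)
Require Import Defs.
From mathcomp Require Import all_boot all_order all_algebra.
From mathcomp Require Import all_classical all_reals all_analysis.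
From mathcomp Require Import ring.
Set Implicit Arguments.
Unset Strict Implicit.
Unset Printing Implicit Defensive.
Import Order.TTheory GRing.Theory Num.Theory.
Import numFieldNormedType.Exports.
Local Open Scope classical_set_scope.
Local Open Scope ring_scope.

(** Why the theorem holds.  Write [g = (Q, b)], and let [c (e, t)] be a smooth
    family of equivariant curves through [gamma] with velocity [Y].  In both
    vectors the arc-length parametrisation cancels, so that for fixed vectors
    [v] and [w] one has to differentiate at [e = 0] the functions

      1/2 int <c x c_t, v> dt - 1/2 <b x c(t0), v>,
      1/3 int <c x (c x c_t), w> dt - 1/6 <c(t0) x (b x c(t0)), w>.

    Differentiating under the integral sign yields integrands involving the
    mixed derivative [c_te], which equals [Y'] by symmetry of second
    derivatives.  Up to total derivatives these integrands are the ones
    required ([area_integral_variation], [volume_integral_variation]):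

      1/2 <Y x gamma' + gamma x Y', v> = det (v, Y, gamma') + G_A',
      1/3 <Y x (gamma x gamma') + gamma x (Y x gamma' + gamma x Y'), w>
        = det (w x gamma, Y, gamma') + G_V',

    where [G_A = 1/2 <gamma x Y, v>] and
    [G_V = 1/3 <w x gamma, gamma x Y>]; the second line uses that
    [x |-> w x x] has trace zero.  What is left are the increments of [G_A] and
    [G_V] over a period and the derivatives of the terms at [t0].

    These boundary terms cancel because [(w, v)] lies in z(g)
    ([area_variation], [volume_variation]).  A curve in the centralizer
    commutes with [g], hence its velocity field [X x = w x x + v] satisfies
    [X (g x) = Q (X x)] ([zlie_equivariant]).  Together with [Q b = b] this
    gives [w x b = 0] and [Q v = v] ([zlie_axis]), which are exactly the
    relations under which the increments and the terms at [t0] cancel. *)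

(** * Vector algebra in dimension three *)

Section VectorAlgebra.
Context {R : realType}.
Implicit Types (u v w x y b : 'cV[R]_3) (Q : 'M[R]_3).

Lemma I3_ind (P : 'I_3 -> Prop) : P 0 -> P 1 -> P 2%:R -> forall i, P i.
Proof.
by move=> P0 P1 P2 i; have /or3P[] : [|| i == 0, i == 1 | i == 2%:R];
  [case: i; do 3?[case=> //] | move/eqP->..].
Qed.

Lemma cV3P u v : u 0 0 = v 0 0 -> u 1 0 = v 1 0 -> u 2%:R 0 = v 2%:R 0 -> u = v.
Proof.
by move=> e0 e1 e2; apply/matrixP => i j; rewrite ord1; elim/I3_ind: i.
Qed.

Lemma dotE u v : dot u v = u 0 0 * v 0 0 + u 1 0 * v 1 0 + u 2%:R 0 * v 2%:R 0.
Proof.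
rewrite /dot !big_ord_recl big_ord0 addr0 addrA.
by do ![congr (_ + _)]; congr (u _ _ * v _ _); exact/val_inj.
Qed.

(** Rewriting with [crossE] before unfolding sums of vectors keeps all indices
    in the form 0, 1, 2, so that [ring] sees nested cross products as
    polynomials in the same coordinates. *)
Lemma crossE u v :
  (cross u v 0 0 = u 1 0 * v 2%:R 0 - u 2%:R 0 * v 1 0) *
  (cross u v 1 0 = u 2%:R 0 * v 0 0 - u 0 0 * v 2%:R 0) *
  (cross u v 2%:R 0 = u 0 0 * v 1 0 - u 1 0 * v 0 0).
Proof.
have e (i j : 'I_3) : val i = val j -> i = j by exact: val_inj.
have e01 : 0 + 1 = 1 :> 'I_3 by exact: e.
have e02 : 0 + 2%:R = 2%:R :> 'I_3 by exact: e.
have e11 : 1 + 1 = 2%:R :> 'I_3 by exact: e.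
have e12 : 1 + 2%:R = 0 :> 'I_3 by exact: e.
have e21 : 2%:R + 1 = 0 :> 'I_3 by exact: e.
have e22 : 2%:R + 2%:R = 1 :> 'I_3 by exact: e.
by rewrite !mxE ?(e01, e02, e11, e12, e21, e22).
Qed.

Lemma det_mx33 (A : 'M[R]_3) : \det A =
  A 0 0 * (A 1 1 * A 2%:R 2%:R - A 2%:R 1 * A 1 2%:R)
  + A 1 0 * (A 2%:R 1 * A 0 2%:R - A 0 1 * A 2%:R 2%:R)
  + A 2%:R 0 * (A 0 1 * A 1 2%:R - A 1 1 * A 0 2%:R).
Proof.
(* Passing through natural number indices lets the ordinals built by the
   cofactor expansions compute. *)
pose f i j : R := A (inord i) (inord j).
have AE i j : A i j = f (val i) (val j) by rewrite /f !inord_val.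
rewrite (expand_det_col _ 0) !big_ord_recl big_ord0 /cofactor.
rewrite !(expand_det_row _ ord0) !big_ord_recl !big_ord0 /cofactor.
rewrite !det_mx11 !mxE !AE /= /bump /= !addr0.
ring.
Qed.

Lemma det3E u v w : det3 u v w = dot u (cross v w).
Proof.
set A : 'M[R]_3 := row_mx u (row_mx v w).
have A0 i : A i 0 = u i 0.
  by rewrite mxE; case: splitP => k //= _; rewrite ord1.
have A1 i : A i 1 = v i 0.
  rewrite mxE; case: splitP => [[[]]|[[|[|k]] lek]] //= _; rewrite mxE.
  by case: splitP => [l _|[[|l] lel]] //=; rewrite ord1.
have A2 i : A i 2%:R = w i 0.
  rewrite mxE; case: splitP => [[[]]|[[|[|k]] lek]] //= _; rewrite mxE.
  by case: splitP => [[[]]|l _] //=; rewrite ord1.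
by rewrite /det3 -/A det_mx33 dotE !crossE !(A0, A1, A2); ring.
Qed.

Lemma dotDl u v w : dot (u + v) w = dot u w + dot v w.
Proof. by rewrite !dotE !mxE; ring. Qed.

Lemma dotBl u v w : dot (u - v) w = dot u w - dot v w.
Proof. by rewrite !dotE !mxE; ring. Qed.

Lemma dotZl k u v : dot (k *: u) v = k * dot u v.
Proof. by rewrite !dotE !mxE; ring. Qed.

Lemma dotDr u v w : dot u (v + w) = dot u v + dot u w.
Proof. by rewrite !dotE !mxE; ring. Qed.

Lemma dotZr k u v : dot u (k *: v) = k * dot u v.
Proof. by rewrite !dotE !mxE; ring. Qed.

Lemma crossDl u v w : cross (u + v) w = cross u w + cross v w.
Proof. by apply: cV3P; rewrite !mxE; ring. Qed.

Lemma crossDr u v w : cross u (v + w) = cross u v + cross u w.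
Proof. by apply: cV3P; rewrite !mxE; ring. Qed.

Lemma crossZl k u v : cross (k *: u) v = k *: cross u v.
Proof. by apply: cV3P; rewrite !mxE; ring. Qed.

Lemma crossZr k u v : cross u (k *: v) = k *: cross u v.
Proof. by apply: cV3P; rewrite !mxE; ring. Qed.

Lemma cross0r u : cross u 0 = 0.
Proof. by rewrite -[X in cross _ X](scale0r 0) crossZr scale0r. Qed.

Lemma dot_eq0 u : dot u u = 0 -> u = 0.
Proof.
move=> uu; apply/matrixP => i j; rewrite ord1 mxE; apply/eqP.
rewrite -[_ == 0]orbb -mulf_eq0; apply/eqP.
by apply: (psumr_eq0P _ uu) => // k _; rewrite -expr2 sqr_ge0.
Qed.

Lemma dot_inj u v : (forall w, dot w u = dot w v) -> u = v.
Proof.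
move=> uv; apply/eqP; rewrite -subr_eq0; apply/eqP/dot_eq0.
have -> : dot (u - v) (u - v) = dot (u - v) u - dot (u - v) v.
  by rewrite !dotE !mxE; ring.
by rewrite uv subrr.
Qed.

Lemma SO3_dot Q u v : SO3 Q -> dot (Q *m u) (Q *m v) = dot u v.
Proof.
have dotM x y : dot x y = (x^T *m y) 0 0.
  by rewrite mxE; apply: eq_bigr => i _; rewrite mxE.
by move=> [QQ _]; rewrite !dotM trmx_mul mulmxA -(mulmxA u^T) QQ mulmx1.
Qed.

(** Both sides have the same product with every vector, by invariance of the
    dot product and of the determinant. *)
Lemma SO3_cross Q u v : SO3 Q -> cross (Q *m u) (Q *m v) = Q *m cross u v.
Proof.
move=> SQ; have [QQ detQ] := SQ; apply: dot_inj => w.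
rewrite -[w]mul1mx -(mulmx1C QQ) -mulmxA SO3_dot // -!det3E.
by rewrite /det3 -!mul_mx_row det_mulmx detQ mul1r.
Qed.

Lemma mulmx_dot (A : 'M[R]_3) u i : (A *m u) i 0 = dot (row i A)^T u.
Proof. by rewrite mxE; apply: eq_bigr => k _; rewrite !mxE. Qed.

Definition cross_mx u : 'M[R]_3 :=
  \matrix_(i, j) cross u (delta_mx j 0) i 0.

Lemma mul_cross_mx u v : cross_mx u *m v = cross u v.
Proof.
have entry i : (cross_mx u *m v) i 0 = cross u (delta_mx 0 0) i 0 * v 0 0 +
    cross u (delta_mx 1 0) i 0 * v 1 0 +
    cross u (delta_mx 2%:R 0) i 0 * v 2%:R 0.
  rewrite mulmx_dot dotE; do ![congr (_ + _ )]; congr (_ * _);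
  by rewrite [LHS]mxE [LHS]mxE [LHS]mxE.
by apply: cV3P; rewrite entry !crossE ![delta_mx _ _ _ _]mxE /=; ring.
Qed.

(** This is the cancellation of the boundary terms of the volume vector, where
    [x] is the start point of the period and [y] its velocity in the family:
    the difference of the two sides is [<w x b, x x y> / 6]. *)
Lemma volume_boundary w b x y : cross w b = 0 ->
  dot (cross (3^-1 *: w) x) (cross x y + cross b y)
    - dot (cross (3^-1 *: w) x) (cross x y)
  = dot (cross y (cross b x) + cross x (cross b y)) (6^-1 *: w).
Proof.
move=> wb; have dot0 v : dot 0 v = 0 by rewrite dotE !mxE; ring.
have {}wb : 6^-1 * dot (cross w b) (cross x y) = 0 by rewrite wb dot0 mulr0.
apply/subr0_eq; rewrite -[RHS]wb.
by rewrite !dotE !(crossE, mxE); field.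
Qed.

End VectorAlgebra.

(** * Derivatives and continuity of vector-valued functions *)

Section VectorDerivatives.
Context {R : realType} {V : normedModType R}.
Implicit Types (f g : V -> 'cV[R]_3).

Lemma is_derive_coord f x v (df : 'cV[R]_3) :
  is_derive x v f df <-> forall i, is_derive x v (fun x => f x i 0) (df i 0).
Proof.
split=> [[fd <-] i|fd].
  have fid := (derivable_mxP f x v).1 fd i 0.
  by apply: DeriveDef => //; rewrite derive_mx// mxE.
have fdx : derivable f x v.
  by apply/derivable_mxP => i j; rewrite ord1; exact: ex_derive.
apply: DeriveDef => //; rewrite derive_mx//; apply/matrixP => i j.
by rewrite mxE ord1; exact: derive_val.
Qed.

Lemma is_derive_dot f g x v df dg :
  is_derive x v f df -> is_derive x v g dg ->
  is_derive x v (fun x => dot (f x) (g x)) (dot df (g x) + dot (f x) dg).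
Proof.
move=> /is_derive_coord fd /is_derive_coord gd.
under eq_fun do rewrite dotE.
apply: (is_derive_eq (is_deriveD (is_deriveD (is_deriveM (fd 0) (gd 0))
  (is_deriveM (fd 1) (gd 1))) (is_deriveM (fd 2%:R) (gd 2%:R)))).
by rewrite !dotE /GRing.scale/=; ring.
Qed.

Lemma is_derive_cross f g x v df dg :
  is_derive x v f df -> is_derive x v g dg ->
  is_derive x v (fun x => cross (f x) (g x))
    (cross df (g x) + cross (f x) dg).
Proof.
move=> /is_derive_coord fd /is_derive_coord gd; apply/is_derive_coord => i.
under eq_fun do rewrite mxE.
apply: (is_derive_eq (is_deriveB (is_deriveM (fd (i + 1)) (gd (i + 2%:R)))
  (is_deriveM (fd (i + 2%:R)) (gd (i + 1))))).
by rewrite !mxE /GRing.scale/=; ring.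
Qed.

Lemma is_derive_mulmx (A : 'M[R]_3) f x v df :
  is_derive x v f df -> is_derive x v (fun x => A *m f x) (A *m df).
Proof.
move=> /is_derive_coord fd; apply/is_derive_coord => i.
under eq_fun do rewrite mxE.
rewrite mxE; have := is_derive_sum (fun k => is_deriveZ (A i k) (fd k)).
by rewrite fct_sumE.
Qed.

End VectorDerivatives.

Section VectorContinuity.
Context {R : realType} {T : topologicalType}.
Implicit Types (f g : T -> 'cV[R]_3).

Lemma continuous_coord f i : continuous f -> continuous (fun x => f x i 0).
Proof.
move=> fc x; exact: (cvg_comp _ (fun M : 'cV[R]_3 => M i 0) (fc x)
  (@coord_continuous _ _ _ i 0 (f x))).
Qed.

Lemma continuous_cV f : (forall i, continuous (fun x => f x i 0)) -> continuous f.
Proof.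
move=> fc x; apply/cvgrPdist_le => /= e e0.
near=> y.
rewrite /Num.Def.normr/= mx_normrE (bigmax_le _ (ltW e0))//= => -[i j] _.
rewrite !mxE/= ord1 /=.
move: i; near: y; apply: filter_forall => /= i.
exact: ((cvgrPdist_le _ _).1 (fc i x)).
Unshelve. all: by end_near. Qed.

Lemma continuous_add f g :
  continuous f -> continuous g -> continuous (fun x => f x + g x).
Proof. by move=> fc gc x; apply: cvgD; [exact: fc | exact: gc]. Qed.

Lemma continuous_dot f g :
  continuous f -> continuous g -> continuous (fun x => dot (f x) (g x)).
Proof.
move=> fc gc x; under eq_fun do rewrite dotE.
by do !apply: cvgD; apply: cvgM; apply: continuous_coord.
Qed.

Lemma continuous_cross f g :
  continuous f -> continuous g -> continuous (fun x => cross (f x) (g x)).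
Proof.
move=> fc gc; apply: continuous_cV => i x.
under eq_fun do rewrite mxE.
by apply: cvgB; apply: cvgM; apply: continuous_coord.
Qed.

End VectorContinuity.

Section SmoothInfinitesimalMotion.
Context {R : realType}.

Lemma differentiable_mulmx (A : 'M[R]_3) (x : 'cV[R]_3) :
  differentiable (fun y : 'cV[R]_3 => A *m y) x.
Proof.
apply: linear_differentiable; apply: continuous_cV => i.
under eq_fun do rewrite mulmx_dot.
apply: (@continuous_dot _ _ (fun=> (row i A)^T) id) => y.
  exact: cst_continuous.
exact: cvg_id.
Qed.

(** The translation part must be allowed to change in the induction, since
    differentiating kills it. *)
Lemma Ck_affine (U : normedModType R) k (A : 'M[R]_3) (w : 'cV[R]_3)
    (f : U -> 'cV[R]_3) : Ck k f -> Ck k (fun x => A *m f x + w).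
Proof.
elim: k f w => [|k IH] f w /=.
  move=> fc x; apply: cvgD; last exact: cvg_cst.
  exact: (cvg_comp _ _ (fc x)
    (differentiable_continuous (differentiable_mulmx A (f x)))).
move=> [fd fC]; split=> [x|v].
  apply: differentiableD; last exact: differentiable_cst.
  exact: (differentiable_comp (fd x) (differentiable_mulmx A (f x))).
have -> : (fun x => 'D_v (fun x => A *m f x + w) x) =
    (fun x => A *m 'D_v f x + 0).
  apply/funext => x; have fx : is_derive x v f ('D_v f x).
    exact/derivableP/diff_derivable.
  by have /@derive_val := is_deriveD (is_derive_mulmx A fx)
    (is_derive_cst w x v).
exact: IH.
Qed.

Lemma smooth_inf_motion (U : normedModType R) xi (f : U -> 'cV[R]_3) :
  smooth f -> smooth (fun x => inf_motion xi (f x)).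
Proof.
move=> fC k; rewrite /inf_motion.
under eq_fun do rewrite -mul_cross_mx.
exact: Ck_affine.
Qed.

End SmoothInfinitesimalMotion.

(** * Variation of integrals depending on a parameter *)

Section ParametricIntegrals.
Context {R : realType}.
Implicit Types (a b t e : R).
Notation mu := (@lebesgue_measure R).

Lemma continuous_slice (T : topologicalType) (f : R * R -> T) e :
  continuous f -> continuous (fun t => f (e, t)).
Proof.
move=> fc t.
have et (x : R) : (e, y) @[y --> x] --> (e, x).
  exact: cvg_pair (cvg_cst e) cvg_id.
exact: (cvg_comp _ _ (et t) (fc (e, t))).
Qed.

Lemma is_derive_fst (V : normedModType R) (f : R * R -> V) e t :
  differentiable f (e, t) ->
  is_derive e 1 (fun e => f (e, t)) ('D_((1 : R, 0 : R)) f (e, t)).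
Proof.
move=> /(@diff_derivable _ _ _ _ _ ((1, 0) : R * R)) fd.
have E : (fun h : R => h^-1 *: ((f \o shift (e, t)) (h *: (1 : R, 0 : R))
      - f (e, t))) =
    (fun h : R => h^-1 *: (((fun e => f (e, t)) \o shift e) (h *: 1)
      - f (e, t))).
  apply/funext => h /=; congr (_ *: (f _ - _)).
  by congr pair; rewrite /= ?scaler0 ?add0r.
by apply: DeriveDef; move: fd; rewrite /derivable /derive E.
Qed.

Lemma is_derive_snd (V : normedModType R) (f : R * R -> V) e t :
  differentiable f (e, t) ->
  is_derive t 1 (fun t => f (e, t)) ('D_((0 : R, 1 : R)) f (e, t)).
Proof.
move=> /(@diff_derivable _ _ _ _ _ ((0, 1) : R * R)) fd.
have E : (fun h : R => h^-1 *: ((f \o shift (e, t)) (h *: (0 : R, 1 : R))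
      - f (e, t))) =
    (fun h : R => h^-1 *: (((fun t => f (e, t)) \o shift t) (h *: 1)
      - f (e, t))).
  apply/funext => h /=; congr (_ *: (f _ - _)).
  by congr pair; rewrite /= ?scaler0 ?add0r.
by apply: DeriveDef; move: fd; rewrite /derivable /derive E.
Qed.

Lemma continuous_integrable (f : R -> R) a b :
  continuous f -> mu.-integrable `[a, b] (EFin \o f).
Proof.
move=> fc; apply: continuous_compact_integrable; first exact: segment_compact.
exact: continuous_subspaceT.
Qed.

Lemma is_derive_continuous (V : normedModType R) (f df : R -> V) :
  (forall t, is_derive t 1 f (df t)) -> continuous f.
Proof.
move=> fd t; apply/differentiable_continuous/derivable1_diffP.
exact: (@ex_derive _ _ _ _ _ _ _ (fd t)).
Qed.

(** The difference quotients are dominated by a constant, namely a bound of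
    the continuous derivative on the compact rectangle [-1, 1] x [a, b]. *)
Lemma is_derive_under_integral (f fe : R * R -> R) a b :
    (forall e, continuous (fun t => f (e, t))) ->
    (forall e t, is_derive e 1 (fun e => f (e, t)) (fe (e, t))) ->
    continuous fe ->
  is_derive (0 : R) 1 (fun e => \int[mu]_(t in `[a, b]) f (e, t))
    (\int[mu]_(t in `[a, b]) fe (0, t)).
Proof.
move=> fc fd fec.
have dE e t : partial1of2 (fun e t => f (e, t)) e t = fe (e, t).
  by rewrite partial1of2E; apply: derive_val.
have [M [_ bM]] : bounded_set (fe @` (`[-1, 1] `*` `[a, b])).
  apply/compact_bounded/continuous_compact; first exact: continuous_subspaceT.
  by apply: compact_setX; exact: segment_compact.
have {}bM e t : `]-1, 1[%classic e -> `[a, b]%classic t ->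
    `|fe (e, t)| <= `|M| + 1.
  move=> e1 tab; apply: bM; first by rewrite ltr_pwDr// ler_norm.
  by exists (e, t) => //; split => //; exact: subset_itv_oo_cc.
have I0 : `]-1, 1[%classic (0 : R) by rewrite /= in_itv/= ltrN10 ltr01.
have mab : measurable `[a, b]%classic by exact: measurable_itv.
have intf e : `]-1, 1[%classic e ->
    mu.-integrable `[a, b] (EFin \o (fun t => f (e, t))).
  by move=> _; exact: continuous_integrable.
have derf e t : `]-1, 1[%classic e -> `[a, b]%classic t ->
    derivable (fun e => f (e, t)) e 1.
  by move=> _ _; apply: ex_derive.
have G0 (t : R) : 0 <= `|M| + 1 by exact: addr_ge0.
have intG : mu.-integrable `[a, b] (EFin \o (fun=> `|M| + 1)).
  by apply: continuous_integrable => t; exact: cvg_cst.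
have Gub e t : `]-1, 1[%classic e -> `[a, b]%classic t ->
    `|partial1of2 (fun e t => f (e, t)) e t| <= `|M| + 1.
  by move=> e1 tab; rewrite dE; exact: bM.
apply: DeriveDef.
  exact: (@derivable_under_integral R _ _ mu (fun e t => f (e, t)) _ mab
    0 (-1) 1 I0 intf derf _ G0 intG Gub).
rewrite -derive1E (@differentiation_under_integral R _ _ mu
  (fun e t => f (e, t)) _ mab 0 (-1) 1 I0 intf derf _ G0 intG Gub).
by apply: eq_Rintegral => t _; exact: dE.
Qed.

Lemma Rintegral_FTC2 (f F : R -> R) a b : a < b -> continuous f ->
  (forall t, is_derive t 1 F (f t)) ->
  \int[mu]_(t in `[a, b]) f t = F b - F a.
Proof.
move=> ab fc Fd; have Fc := is_derive_continuous Fd.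
rewrite /Rintegral (@continuous_FTC2 _ f F)//.
- exact: continuous_subspaceT.
- split => [t _||]; first exact: ex_derive.
  + by apply: cvg_at_right_filter; exact: Fc.
  + by apply: cvg_at_left_filter; exact: Fc.
- by move=> t _; rewrite derive1E; exact: derive_val.
Qed.

(** Symmetry of second derivatives: differentiating
    [u (e, x) = u (e, a) + int_a^x ut (e, s) ds] in [e] under the integral sign
    exhibits [ue] as a primitive of [uet (0, _)]. *)
Lemma is_derive_mixed (u ut uet : R * R -> R) (ue : R -> R) :
    (forall e t, is_derive t 1 (fun t => u (e, t)) (ut (e, t))) ->
    (forall e, continuous (fun t => ut (e, t))) ->
    (forall t, is_derive (0 : R) 1 (fun e => u (e, t)) (ue t)) ->
    (forall e t, is_derive e 1 (fun e => ut (e, t)) (uet (e, t))) ->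
    continuous uet ->
  forall t, is_derive t 1 ue (uet (0, t)).
Proof.
move=> u_t utc u_e ut_e uetc t.
(* The base point of the primitive only has to lie strictly below [t]. *)
pose a := t - 1.
have ueE x : a < x -> ue x = ue a + \int[mu]_(s in `[a, x]) uet (0, s).
  move=> ax; have := is_derive_under_integral a x utc ut_e uetc.
  under eq_fun do rewrite (Rintegral_FTC2 ax (utc _) (u_t _)).
  have := is_deriveB (u_e x) (u_e a).
  move=> /(@derive_val _ _ _ _ _ _ _) d1 /(@derive_val _ _ _ _ _ _ _) d2.
  by move: d1; rewrite d2 => ->; rewrite addrC subrK.
have cu := continuous_slice (e := 0) uetc.
have at1 : a < t by rewrite /a ltrBlDr ltrDl.
have tt1 : t < t + 1 by rewrite ltrDl.
have [d1 d2] := continuous_FTC1_closed tt1 (continuous_integrable a (t + 1) cu)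
  at1 (cu t).
have dI : is_derive t 1 (fun x => \int[mu]_(s in `[a, x]) uet (0, s))
    (uet (0, t)).
  by apply: DeriveDef; [exact: d1 | rewrite -derive1E; exact: d2].
have dF := is_deriveD (is_derive_cst (ue a) t 1) dI.
rewrite add0r in dF.
apply: near_eq_is_derive dF.
near=> x; apply/esym/ueE; near: x.
exact: lt_nbhsr.
Unshelve. all: by end_near. Qed.

(** The formula of the calculus of variations: an integration by parts
    replaces the varied integrand [fe (0, _)] by [k], at the price of the
    boundary term of [G]. *)
Lemma first_variation (f fe : R * R -> R) (k G : R -> R) a b : a < b ->
    (forall e, continuous (fun t => f (e, t))) ->
    (forall e t, is_derive e 1 (fun e => f (e, t)) (fe (e, t))) ->
    continuous fe -> continuous k ->
    (forall t, is_derive t 1 G (fe (0, t) - k t)) ->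
  is_derive (0 : R) 1 (fun e => \int[mu]_(t in `[a, b]) f (e, t))
    (\int[mu]_(t in `[a, b]) k t + (G b - G a)).
Proof.
move=> ab fc fd fec kc Gd.
have cfe := continuous_slice (e := 0) fec.
rewrite -(Rintegral_FTC2 ab _ Gd); last first.
  by move=> t; apply: cvgB; [exact: cfe|exact: kc].
rewrite RintegralB//; last 2 first.
- exact: continuous_integrable.
- exact: continuous_integrable.
rewrite addrC subrK; exact: is_derive_under_integral.
Qed.

End ParametricIntegrals.

(** * Infinitesimal motions commuting with a rigid motion *)

Section CentralizerLieAlgebra.
Context {R : realType}.
Implicit Types (g : 'M[R]_3 * 'cV[R]_3) (xi : 'cV[R]_3 * 'cV[R]_3).

(** Obtained by differentiating [h (g x) = g (h x)] along a curve [h] in the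
    centralizer. *)
Lemma zlie_equivariant g xi x : zlie g xi ->
  inf_motion xi (act g x) = g.1 *m inf_motion xi x.
Proof.
move=> [h [_ _ hZ hd]].
have hg e : act (h e) (act g x) = act g (act (h e) x).
  have [_ [eq1 eq2]] := hZ e.
  by rewrite /act !mulmxDr !mulmxA eq1 -!addrA eq2.
have := is_deriveD (is_derive_mulmx g.1 (hd x)) (is_derive_cst g.2 (0 : R) 1).
have := hd (act g x).
under eq_fun do rewrite hg.
by move=> /@derive_val <- /@derive_val; rewrite addr0.
Qed.

Lemma zlie_cross g xi x : zlie g xi ->
  cross xi.1 (g.1 *m x) = g.1 *m cross xi.1 x.
Proof.
move=> xiz; have := zlie_equivariant x xiz; have := zlie_equivariant 0 xiz.
rewrite /act /inf_motion mulmx0 add0r crossDr !mulmxDr -!addrA.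
rewrite cross0r mulmx0 add0r => ->; exact: addIr.
Qed.

(** Equivariance at the origin reads [w x b = Q v - v], where [(w, v) = xi] and
    [(Q, b) = g].  The left side is fixed by [Q], hence orthogonal to the image
    of [Q - 1], to which the right side belongs; so both vanish.  This treats
    [Q = 1] and [Q <> 1] at once. *)
Lemma zlie_axis g xi : SE3 g -> g.1 *m g.2 = g.2 -> zlie g xi ->
  cross xi.1 g.2 = 0 /\ g.1 *m xi.2 = xi.2.
Proof.
move=> hg gb xiz; have := zlie_equivariant 0 xiz.
rewrite /act /inf_motion mulmx0 add0r cross0r add0r => xb.
have wR : g.1 *m cross xi.1 g.2 = cross xi.1 g.2 by rewrite -zlie_cross // gb.
suff w0 : cross xi.1 g.2 = 0 by split=> //; rewrite -xb w0 add0r.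
apply: dot_eq0; have := SO3_dot xi.2 (cross xi.1 g.2) hg.
by rewrite wR -xb dotDl => /(canRL (addrK _)); rewrite subrr.
Qed.

End CentralizerLieAlgebra.

(** * Independence of the parametrisation *)

Section ArcLength.
Context {R : realType}.
Notation mu := (@lebesgue_measure R).

Lemma speed_neq0 (gamma : R -> 'cV[R]_3) t :
  derive1 gamma t != 0 -> speed gamma t != 0.
Proof.
apply: contra_neq => /eqP; rewrite sqrtr_eq0 => g0.
apply/dot_eq0/eqP; rewrite eq_le g0 sumr_ge0 // => i _.
by rewrite -expr2 sqr_ge0.
Qed.

Lemma scale_arc_deriv (gamma : R -> 'cV[R]_3) t : derive1 gamma t != 0 ->
  speed gamma t *: arc_deriv gamma t = derive1 gamma t.
Proof. by move=> g0; rewrite /arc_deriv scalerA divff ?scale1r ?speed_neq0. Qed.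

(** Integrands linear in the arc-length derivative are integrated by replacing
    it with the derivative in [t]; continuity of the result is what allows the
    integral to be taken out of the dot product. *)
Lemma dot_int_ds (T0 t0 : R) (gamma F G : R -> 'cV[R]_3) w :
  continuous G -> (forall t, speed gamma t *: F t = G t) ->
  dot (int_ds T0 t0 gamma F) w =
  \int[mu]_(t in `[t0, tau T0 t0]) dot (G t) w.
Proof.
move=> Gc FG.
have Gi i : continuous (fun t => G t i 0) by exact: continuous_coord.
have Gw i : continuous (fun t => G t i 0 * w i 0).
  by move=> t; apply: cvgM; [exact: Gi | exact: cst_continuous].
have iE i : int_ds T0 t0 gamma F i 0 * w i 0 =
    \int[mu]_(t in `[t0, tau T0 t0]) (G t i 0 * w i 0).
  rewrite mxE RintegralZr//; last exact: continuous_integrable.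
  by congr (_ * _); apply: eq_Rintegral => t _; rewrite -FG mxE mulrC.
under eq_Rintegral do rewrite dotE.
rewrite !RintegralD ?dotE ?iE //; apply: continuous_integrable => // t.
by apply: cvgD; exact: Gw.
Qed.

End ArcLength.

(** * First variation of the area and volume vectors *)

Section Variation.
Context {R : realType}.
Notation mu := (@lebesgue_measure R).

(** Naming the partial derivatives of a family of curves makes its variation
    formulas polynomial identities in the values of [c], [ct], [ce], [cte]. *)
Record partials (c ct ce cte : R * R -> 'cV[R]_3) : Prop := Partials {
  c_cont : continuous c;
  ct_cont : continuous ct;
  ce_cont : continuous ce;
  cte_cont : continuous cte;
  c_t : forall e t : R, is_derive t 1 (fun t => c (e, t)) (ct (e, t));
  c_e : forall e t : R, is_derive e 1 (fun e => c (e, t)) (ce (e, t));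
  ct_e : forall e t : R, is_derive e 1 (fun e => ct (e, t)) (cte (e, t)) }.

Lemma smooth_partials (c : R * R -> 'cV[R]_3) : smooth c ->
  exists ct ce cte, partials c ct ce cte.
Proof.
move=> cC; exists ('D_((0 : R, 1 : R)) c), ('D_((1 : R, 0 : R)) c).
exists ('D_((1 : R, 0 : R)) ('D_((0 : R, 1 : R)) c)); split.
- exact: (cC 0).
- exact: (cC 1).2.
- exact: (cC 1).2.
- exact: ((cC 2).2 _).2.
- by move=> e t; apply: is_derive_snd; exact: (cC 1).1.
- by move=> e t; apply: is_derive_fst; exact: (cC 1).1.
- move=> e t; apply: (is_derive_fst (f := 'D_((0 : R, 1 : R)) c)).
  exact: ((cC 2).2 _).1.
Qed.

Context (c ct ce cte : R * R -> 'cV[R]_3) (cP : partials c ct ce cte).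

Lemma ce_t (t : R) : is_derive t 1 (fun t => ce (0, t)) (cte (0, t)).
Proof.
apply/is_derive_coord => i.
apply: (@is_derive_mixed _ (fun s => c s i 0) (fun s => ct s i 0)
  (fun s => cte s i 0) (fun t => ce (0, t) i 0)).
- by move=> e s; have /is_derive_coord := c_t cP e s.
- move=> e; apply: (@continuous_coord _ _ (fun t => ct (e, t))).
  by apply: (continuous_slice (f := ct)); exact: ct_cont cP.
- by move=> s; have /is_derive_coord := c_e cP 0 s.
- by move=> e s; have /is_derive_coord := ct_e cP e s.
- exact/(continuous_coord (f := cte))/(cte_cont cP).
Qed.

Lemma derive1_family (e t : R) : derive1 (fun t => c (e, t)) t = ct (e, t).
Proof. by rewrite derive1E; have /@derive_val := c_t cP e t. Qed.

Context (T0 : R) (hT0 : 0 < T0) (g : 'M[R]_3 * 'cV[R]_3) (t0 : R).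
Context (hg : SE3 g) (gb : g.1 *m g.2 = g.2).
Context (cM : \forall e \near (0 : R), Mg T0 g (fun t => c (e, t))).
Context (ceM : ce (0, tau T0 t0) = g.1 *m ce (0, t0)).

Let tt0 : t0 < tau T0 t0. Proof. by rewrite /tau ltrDl. Qed.

Let cM0 : c (0, tau T0 t0) = act g (c (0, t0)).
Proof. by have [_ _] := nbhs_singleton cM; apply. Qed.

(** The weight 1/2 is attached to the vector [w], so that no scalar has to be
    moved through the integral. *)
Lemma area_integral_variation w :
  is_derive (0 : R) (1 : R)
    (fun e => \int[mu]_(t in `[t0, tau T0 t0])
       dot (cross (c (e, t)) (ct (e, t))) (2^-1 *: w))
    (\int[mu]_(t in `[t0, tau T0 t0]) det3 w (ce (0, t)) (ct (0, t))
     + (dot (cross (c (0, tau T0 t0)) (ce (0, tau T0 t0))) (2^-1 *: w)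
        - dot (cross (c (0, t0)) (ce (0, t0))) (2^-1 *: w))).
Proof.
have [cc ctc cec ctec _ _ _] := cP.
have wc (T : topologicalType) u : continuous (fun _ : T => u : 'cV[R]_3).
  exact: cst_continuous.
apply: (@first_variation _
  (fun s => dot (cross (c s) (ct s)) (2^-1 *: w))
  (fun s => dot (cross (ce s) (ct s) + cross (c s) (cte s)) (2^-1 *: w))
  (fun t => det3 w (ce (0, t)) (ct (0, t)))
  (fun t => dot (cross (c (0, t)) (ce (0, t))) (2^-1 *: w)) _ _ tt0).
- move=> e; apply: (continuous_slice
    (f := fun s => dot (cross (c s) (ct s)) (2^-1 *: w))).
  exact: continuous_dot (continuous_cross cc ctc) (wc _ _).
- move=> e t; have H := is_derive_dot (is_derive_cross (c_e cP e t)
    (ct_e cP e t)) (is_derive_cst (2^-1 *: w) e 1).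
  by apply: is_derive_eq H _; rewrite !dotE !mxE; ring.
- apply: continuous_dot (wc _ _); apply: continuous_add.
    exact: continuous_cross cec ctc.
  exact: continuous_cross cc ctec.
- under eq_fun do rewrite det3E.
  apply: continuous_dot (wc _ _) _.
  by apply: continuous_cross; exact: continuous_slice.
- move=> t; have H := is_derive_dot (is_derive_cross (c_t cP 0 t) (ce_t t))
    (is_derive_cst (2^-1 *: w) t 1).
  by apply: is_derive_eq H _; rewrite det3E !dotE !mxE; field.
Qed.

(** The increment of [<c x ce, w> / 2] over a period is [<b x ce, w> / 2] at
    [t0], because [w] and [b] are fixed by the rotation; this is the derivative
    of the correction term in the area vector. *)
Lemma area_variation w : g.1 *m w = w ->
  is_derive (0 : R) (1 : R)
    (fun e => dot (area_vector T0 g t0 (fun t => c (e, t))) w)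
    (\int[mu]_(t in `[t0, tau T0 t0]) det3 w (ce (0, t)) (ct (0, t))).
Proof.
move=> gw.
have [cc ctc _ _ _ _ _] := cP.
have integrand_cont e : continuous (fun t => cross (c (e, t)) (ct (e, t))).
  by apply: continuous_cross; exact: continuous_slice.
have areaE : \forall e \near (0 : R),
    \int[mu]_(t in `[t0, tau T0 t0])
       dot (cross (c (e, t)) (ct (e, t))) (2^-1 *: w)
    - dot (cross g.2 (c (e, t0))) (2^-1 *: w)
    = dot (area_vector T0 g t0 (fun t => c (e, t))) w.
  apply: filterS cM => e [_ c'0 _].
  rewrite /area_vector dotBl !dotZl (dot_int_ds _ _ _ (integrand_cont e)).
    rewrite -RintegralZl//; last first.
      apply: continuous_integrable.
      exact: continuous_dot (integrand_cont e) (@cst_continuous _ _ w).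
    rewrite dotZr; congr (_ - _).
    by apply: eq_Rintegral => t _; rewrite dotZr.
  by move=> t; rewrite -crossZr scale_arc_deriv ?c'0// derive1_family.
apply: (near_eq_is_derive areaE).
have dB := is_derive_dot (is_derive_cross (is_derive_cst g.2 (0 : R) 1)
  (c_e cP 0 t0)) (is_derive_cst (2^-1 *: w) (0 : R) 1).
apply: is_derive_eq (is_deriveB (area_integral_variation w) dB) _.
have gw' : g.1 *m (2^-1 *: w) = 2^-1 *: w by rewrite -scalemxAr gw.
have inv u : dot (g.1 *m u) (2^-1 *: w) = dot u (2^-1 *: w).
  by rewrite -{1}gw' SO3_dot.
rewrite ceM cM0 /act crossDl SO3_cross // dotDl inv.
by rewrite -{1}gb SO3_cross // inv !dotE !mxE; ring.
Qed.

Lemma volume_integral_variation w :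
  is_derive (0 : R) (1 : R)
    (fun e => \int[mu]_(t in `[t0, tau T0 t0])
       dot (cross (c (e, t)) (cross (c (e, t)) (ct (e, t)))) (3^-1 *: w))
    (\int[mu]_(t in `[t0, tau T0 t0])
       det3 (cross w (c (0, t))) (ce (0, t)) (ct (0, t))
     + (dot (cross (3^-1 *: w) (c (0, tau T0 t0)))
          (cross (c (0, tau T0 t0)) (ce (0, tau T0 t0)))
        - dot (cross (3^-1 *: w) (c (0, t0)))
            (cross (c (0, t0)) (ce (0, t0))))).
Proof.
have [cc ctc cec ctec _ _ _] := cP.
have wc (T : topologicalType) u : continuous (fun _ : T => u : 'cV[R]_3).
  exact: cst_continuous.
apply: (@first_variation _
  (fun s => dot (cross (c s) (cross (c s) (ct s))) (3^-1 *: w))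
  (fun s => dot (cross (ce s) (cross (c s) (ct s)) +
     cross (c s) (cross (ce s) (ct s) + cross (c s) (cte s))) (3^-1 *: w))
  (fun t => det3 (cross w (c (0, t))) (ce (0, t)) (ct (0, t)))
  (fun t => dot (cross (3^-1 *: w) (c (0, t))) (cross (c (0, t)) (ce (0, t))))
  _ _ tt0).
- move=> e; apply: (continuous_slice
    (f := fun s => dot (cross (c s) (cross (c s) (ct s))) (3^-1 *: w))).
  apply: continuous_dot (wc _ _).
  exact: continuous_cross cc (continuous_cross cc ctc).
- move=> e t; have H := is_derive_dot (is_derive_cross (c_e cP e t)
    (is_derive_cross (c_e cP e t) (ct_e cP e t)))
    (is_derive_cst (3^-1 *: w) e 1).
  by apply: is_derive_eq H _; rewrite !dotE !(crossE, mxE); ring.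
- apply: continuous_dot (wc _ _); apply: continuous_add.
    exact: continuous_cross cec (continuous_cross cc ctc).
  exact: continuous_cross cc (continuous_add (continuous_cross cec ctc)
    (continuous_cross cc ctec)).
- under eq_fun do rewrite det3E.
  apply: continuous_dot.
    by apply: continuous_cross (wc _ _) _; exact: continuous_slice.
  by apply: continuous_cross; exact: continuous_slice.
- move=> t; have H := is_derive_dot
    (is_derive_cross (is_derive_cst (3^-1 *: w) t 1) (c_t cP 0 t))
    (is_derive_cross (c_t cP 0 t) (ce_t t)).
  by apply: is_derive_eq H _; rewrite det3E !dotE !(crossE, mxE); field.
Qed.

(** The boundary terms at [tau t0] are carried back to [t0] by the motion [g],
    with which [x |-> w x x] commutes, and then cancel by [volume_boundary]. *)
Lemma volume_variation w : cross w g.2 = 0 ->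
    (forall x, cross w (g.1 *m x) = g.1 *m cross w x) ->
  is_derive (0 : R) (1 : R)
    (fun e => dot (volume_vector T0 g t0 (fun t => c (e, t))) w)
    (\int[mu]_(t in `[t0, tau T0 t0])
       det3 (cross w (c (0, t))) (ce (0, t)) (ct (0, t))).
Proof.
move=> wb gw.
have [cc ctc _ _ _ _ _] := cP.
have integrand_cont e :
    continuous (fun t => cross (c (e, t)) (cross (c (e, t)) (ct (e, t)))).
  by do ?apply: continuous_cross; exact: continuous_slice.
have volumeE : \forall e \near (0 : R),
    \int[mu]_(t in `[t0, tau T0 t0])
       dot (cross (c (e, t)) (cross (c (e, t)) (ct (e, t)))) (3^-1 *: w)
    - dot (cross (c (e, t0)) (cross g.2 (c (e, t0)))) (6^-1 *: w)
    = dot (volume_vector T0 g t0 (fun t => c (e, t))) w.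
  apply: filterS cM => e [_ c'0 _].
  rewrite /volume_vector dotBl !dotZl (dot_int_ds _ _ _ (integrand_cont e)).
    rewrite -RintegralZl//; last first.
      apply: continuous_integrable.
      exact: continuous_dot (integrand_cont e) (@cst_continuous _ _ w).
    rewrite dotZr; congr (_ - _).
    by apply: eq_Rintegral => t _; rewrite dotZr.
  by move=> t; rewrite -!crossZr scale_arc_deriv ?c'0// derive1_family.
apply: (near_eq_is_derive volumeE).
have dB : is_derive (0 : R) 1
    (fun e => dot (cross (c (e, t0)) (cross g.2 (c (e, t0)))) (6^-1 *: w))
    (dot (cross (ce (0, t0)) (cross g.2 (c (0, t0))) +
          cross (c (0, t0)) (cross g.2 (ce (0, t0)))) (6^-1 *: w)).
  have H := is_derive_dot (is_derive_cross (c_e cP 0 t0)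
    (is_derive_cross (is_derive_cst g.2 (0 : R) 1) (c_e cP 0 t0)))
    (is_derive_cst (6^-1 *: w) (0 : R) 1).
  by apply: is_derive_eq H _; rewrite !dotE !(crossE, mxE) /cst; ring.
apply: is_derive_eq (is_deriveB (volume_integral_variation w) dB) _.
have wact x : cross (3^-1 *: w) (act g x) = g.1 *m cross (3^-1 *: w) x.
  by rewrite !crossZl crossDr wb addr0 gw scalemxAr.
have crossact x y :
    cross (act g x) (g.1 *m y) = g.1 *m (cross x y + cross g.2 y).
  by rewrite crossDl SO3_cross // -{1}gb SO3_cross // mulmxDr.
rewrite ceM cM0 wact crossact SO3_dot //.
by rewrite -addrA (volume_boundary _ _ wb) subrr addr0.
Qed.

End Variation.

(** * The momentum map *)

Section MomentumMap.
Context {R : realType} (T0 : R) (g : 'M[R]_3 * 'cV[R]_3) (t0 : R).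

Lemma zdual_mu_g gamma : zdual (mu_g T0 g t0 gamma).
Proof.
by move=> a x y z zE; rewrite /mu_g /iota_dual /pairing zE /= !dotDr !dotZr; ring.
Qed.

Lemma TMg_gen_field gamma (xi : 'cV[R]_3 * 'cV[R]_3) :
  zlie g xi -> Mg T0 g gamma -> TMg T0 g (gen_field xi gamma).
Proof.
move=> xiz [gC _ gM]; split; first exact: smooth_inf_motion.
by move=> t; rewrite /gen_field gM zlie_equivariant.
Qed.

Lemma is_differential_mu_g gamma (xi : zlie g) Y :
  0 < T0 -> SE3 g -> g.1 *m g.2 = g.2 -> TMg T0 g Y ->
  is_differential T0 g (fun c => mu_g T0 g t0 c xi) gamma Y
    (OmegaMW T0 t0 gamma (gen_field (\val xi) gamma) Y).
Proof.
move=> T0_gt0 hg gb [_ YM] c cC cM c0 cY.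
have xiz : zlie g (\val xi) by exact: set_valP.
have [wb gv] := zlie_axis hg gb xiz.
have [ct [ce [cte cP]]] := smooth_partials cC.
have ceY t : ce (0, t) = Y t.
  by have /@derive_val <- := c_e cP 0 t; have /@derive_val := cY t.
have ct_gamma t : ct (0, t) = derive1 gamma t.
  by rewrite -(derive1_family cP); congr (derive1 _ t); apply/funext.
have ceM : ce (0, tau T0 t0) = g.1 *m ce (0, t0) by rewrite !ceY YM.
have dV := volume_variation cP T0_gt0 hg gb cM ceM wb
  (fun x => zlie_cross x xiz).
have dA := area_variation cP T0_gt0 hg gb cM ceM gv.
apply: is_derive_eq (is_deriveD dV dA) _.
have [cc ctc cec _ _ _ _] := cP.
have wc (T : topologicalType) u : continuous (fun _ : T => u : 'cV[R]_3).
  exact: cst_continuous.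
rewrite -RintegralD//.
- apply: eq_Rintegral => t _.
  by rewrite c0 ceY ct_gamma !det3E -dotDl.
- apply: continuous_integrable.
  under eq_fun do rewrite det3E.
  apply: continuous_dot.
    by apply: continuous_cross (wc _ _) _; exact: continuous_slice.
  by apply: continuous_cross; exact: continuous_slice.
- apply: continuous_integrable.
  under eq_fun do rewrite det3E.
  apply: continuous_dot (wc _ _) _.
  by apply: continuous_cross; exact: continuous_slice.
Qed.

End MomentumMap.

Theorem theorem3p4 (R : realType) (T0 : R) (hT0 : 0 < T0)
    (g : 'M[R]_3 * 'cV[R]_3) (hg : SE3 g)
    (* if R <> Id, the origin lies on the screw axis of g *)
    (haxis : g.1 <> 1%:M -> g.1 *m g.2 = g.2)
    (t0 : R) :
  is_momentum_map T0 g t0 (mu_g T0 g t0).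
Proof.
have gb : g.1 *m g.2 = g.2.
  by have [->|/eqP/haxis] := eqVneq g.1 1%:M; first rewrite mul1mx.
move=> gamma gM; split; first exact: zdual_mu_g.
move=> xi; split; first exact: TMg_gen_field (set_valP xi) gM.
by move=> Y YT; exact: is_differential_mu_g.
Qed.
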